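(* Let $E$ and $F$ be Banach lattices and let $T\in\mathrm{L}(E,F)$. The following holds. (i) $T$ is a $[\mathrm{d}]$-operator if and only if $T$ is almost o-limited. (ii) $T$ is an $[\mathrm{sw}^*\mathrm{l}]$-operator if and only if $T$ is o-limited.
   Context: All vector spaces are real; operators are linear and bounded; $\mathrm{L}(E,F)$ is the space of bounded operators from $E$ to $F$. $E_+$ is the positive cone, $E',F'$ are norm duals, $T'$ is the adjoint of $T$. ''w$^*$-null'' means weak$^*$ convergent to $0$ in a dual space. A sequence $(f_n)$ in a Banach lattice is disjoint if $|f_n|\wedge|f_m|=0$ for $n\ne m$. A bounded set $A\subseteq F$ is limited if each w$^*$-null sequence $(f_n)$ in $F'$ is uniformly null on $A$ (i.e. $\sup_{a\in A}|f_n(a)|\to0$), and a-limited (almost limited) if each disjoint w$^*$-null sequence in $F'$ is uniformly null on $A$. $T:E\to F$ is o-limited if $T[0,x]$ is limited for all $x\in E_+$, and almost o-limited if $T[0,x]$ is a-limited for all $x\in E_+$. $T:E\to F$ is a $[\mathrm{d}]$-operator if $(|T'f_n|)$ is w$^*$-null in $E'$ for each disjoint w$^*$-null $(f_n)$ in $F'$, and an $[\mathrm{sw}^*\mathrm{l}]$-operator if $(|T'f_n|)$ is w$^*$-null in $E'$ for each w$^*$-null $(f_n)$ in $F'$. *)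

(* Defs.v *)
From HB Require Import structures.
From mathcomp Require Import all_boot all_order all_algebra.
From mathcomp Require Import all_classical all_reals all_analysis.

Set Implicit Arguments.
Unset Strict Implicit.
Unset Printing Implicit Defensive.

Import Order.TTheory GRing.Theory Num.Theory.
Import numFieldNormedType.Exports.

Local Open Scope classical_set_scope.
Local Open Scope ring_scope.

(* HB cannot join the Order and the NormedModule hierarchies, hence a record
   whose carrier receives the instances of both.  In banach_lattice_norm, the
   hypothesis compares the lattice moduli of x and y; `|x| is the norm. *)
Record banachLatticeType (R : realType) := BanachLattice {
  banach_space : completeNormedModType R ;
  banach_le : rel banach_space ;
  banach_meet : banach_space -> banach_space -> banach_space ;
  banach_join : banach_space -> banach_space -> banach_space ;
  banach_le_refl : reflexive banach_le ;
  banach_le_anti : antisymmetric banach_le ;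
  banach_le_trans : transitive banach_le ;
  banach_meetP : forall x y z,
    banach_le x (banach_meet y z) = banach_le x y && banach_le x z ;
  banach_joinP : forall x y z,
    banach_le (banach_join x y) z = banach_le x z && banach_le y z ;
  banach_leD : forall x y z, banach_le x y -> banach_le (x + z) (y + z) ;
  banach_leZ : forall (a : R) x y,
    0 <= a -> banach_le x y -> banach_le (a *: x) (a *: y) ;
  banach_lattice_norm : forall x y,
    banach_le (banach_join x (- x)) (banach_join y (- y)) -> `|x| <= `|y|
}.

Definition banach_sort (R : realType) (E : banachLatticeType R) : Type :=
  banach_space E.

Coercion banach_sort : banachLatticeType >-> Sortclass.

Section BanachLatticeInstances.
Context (R : realType) (E : banachLatticeType R).

HB.instance Definition _ := CompleteNormedModule.copy E (banach_space E).
HB.instance Definition _ := Order.Le_isPOrder.Build ring_display E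
  (@banach_le_refl R E) (@banach_le_anti R E) (@banach_le_trans R E).
HB.instance Definition _ := Order.POrder_MeetJoin_isLattice.Build ring_display E
  (@banach_meetP R E) (@banach_joinP R E).

End BanachLatticeInstances.

Section BoundedOperator.
Context {R : realType}.

Record bounded_operator (E F : normedModType R) := BoundedOperator {
  operator_fun :> {linear E -> F} ;
  operator_bounded : exists M : R, forall x, `|operator_fun x| <= M * `|x|
}.

Definition dual (E : normedModType R) := bounded_operator E R^o.

Lemma operator_ext (E F : normedModType R) (S T : bounded_operator E F) :
  (forall x, S x = T x) -> S = T.
Proof.
case: S T => [S bS] [T bT] /= ST.
have eqST : S = T.
  case: S T ST {bS bT} => [S cS] [T cT] /= ST.
  have eqf : S = T by apply/funext.
  move: cS; rewrite {}eqf => cS; congr GRing.Linear.Pack.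
  case: cS cT => [[a] [b]] [[a'] [b']].
  by rewrite (Prop_irrelevance a a') (Prop_irrelevance b b').
by move: bS; rewrite eqST => bS; rewrite (Prop_irrelevance bS bT).
Qed.

Section Adjoint.
Variables (E F : normedModType R) (T : bounded_operator E F) (f : dual F).

Lemma adjoint_bounded : exists M : R, forall x, `|(f \o T) x| <= M * `|x|.
Proof.
have [M fM] := operator_bounded f; have [N TN] := operator_bounded T.
exists (`|M| * N) => x; apply: le_trans (fM _) _.
apply: (@le_trans _ _ (`|M| * `|T x|)).
  by apply: ler_wpM2r => //; exact: ler_norm.
by rewrite -mulrA; apply: ler_wpM2l.
Qed.

Definition adjoint : dual E :=
  @BoundedOperator E R^o (f \o T : {linear E -> R^o}) adjoint_bounded.

End Adjoint.

Section DualOperations.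
Variable E : normedModType R.

Lemma dual0_bounded : exists M : R, forall x : E, `|(\0 : E -> R^o) x| <= M * `|x|.
Proof. by exists 0 => x; rewrite normr0 mul0r. Qed.

Definition dual0 : dual E :=
  @BoundedOperator E R^o (\0 : {linear E -> R^o}) dual0_bounded.

Lemma dual_opp_bounded (f : dual E) :
  exists M : R, forall x, `|(\- f) x| <= M * `|x|.
Proof.
by have [M fM] := operator_bounded f; exists M => x; rewrite /= normrN.
Qed.

Definition dual_opp (f : dual E) : dual E :=
  @BoundedOperator E R^o (\- f : {linear E -> R^o}) (dual_opp_bounded f).

HB.instance Definition _ := gen_eqMixin (dual E).
HB.instance Definition _ := gen_choiceMixin (dual E).

End DualOperations.
End BoundedOperator.

Section DualLattice.
Context {R : realType} (E : banachLatticeType R).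
Implicit Types f g h : dual E.

Definition dual_le f g : bool := `[< forall x : E, 0 <= x -> f x <= g x >].

Lemma dual_le_refl : reflexive dual_le.
Proof. by move=> f; apply/asboolP. Qed.

Lemma dual_le_anti : antisymmetric dual_le.
Proof.
move=> f g /andP[/asboolP fg /asboolP gf]; apply: operator_ext => x.
have eq_pos y : 0 <= y -> f y = g y.
  by move=> y0; apply/le_anti; rewrite fg ?gf.
pose p : E := Order.join x 0.
have p0 : 0 <= p by exact: leUr.
have px0 : 0 <= p - x by rewrite -(subrr x); apply: banach_leD; exact: leUl.
have subE (h : dual E) : h (p - x) = h p - h x by exact: raddfB.
have := eq_pos _ px0; rewrite !subE (eq_pos p p0) => /addrI; exact: oppr_inj.
Qed.

Lemma dual_le_trans : transitive dual_le.
Proof.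
move=> g f h /asboolP fg /asboolP gh; apply/asboolP => x x0.
exact: le_trans (fg _ x0) (gh _ x0).
Qed.

HB.instance Definition _ := Order.Le_isPOrder.Build ring_display (dual E)
  dual_le_refl dual_le_anti dual_le_trans.

(* By the Riesz-Kantorovich theorem this order makes the dual a lattice, so that
   the default value dual0 of [supremum] and [infimum] is never used below. *)
Definition dual_abs f : dual E := supremum (dual0 E) [set f; dual_opp f].

Definition dual_meet f g : dual E := infimum (dual0 E) [set f; g].

Definition disjoint_seq (f : nat -> dual E) : Prop :=
  forall n m, n <> m -> dual_meet (dual_abs (f n)) (dual_abs (f m)) = dual0 E.

End DualLattice.

Definition weakstar_null (R : realType) (E : normedModType R)
    (f : nat -> dual E) : Prop :=
  forall x : E, f n x @[n --> \oo] --> (0 : R).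

Definition uniformly_null (R : realType) (F : normedModType R)
    (f : nat -> dual F) (A : set F) : Prop :=
  sup [set `|f n a| | a in A] @[n --> \oo] --> (0 : R).

Section Limited.
Context {R : realType}.

Definition limited (F : normedModType R) (A : set F) : Prop :=
  bounded_set A /\
  forall f : nat -> dual F, weakstar_null f -> uniformly_null f A.

Definition almost_limited (F : banachLatticeType R) (A : set F) : Prop :=
  bounded_set A /\
  forall f : nat -> dual F,
    disjoint_seq f -> weakstar_null f -> uniformly_null f A.

Variables E F : banachLatticeType R.
Implicit Type T : bounded_operator E F.

Definition o_limited T : Prop :=
  forall x : E, 0 <= x -> limited (T @` [set y | 0 <= y <= x]).

Definition almost_o_limited T : Prop :=
  forall x : E, 0 <= x -> almost_limited (T @` [set y | 0 <= y <= x]).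

Definition d_operator T : Prop :=
  forall f : nat -> dual F, disjoint_seq f -> weakstar_null f ->
    weakstar_null (fun n => dual_abs (adjoint T (f n))).

Definition swl_operator T : Prop :=
  forall f : nat -> dual F, weakstar_null f ->
    weakstar_null (fun n => dual_abs (adjoint T (f n))).

End Limited.

(* Main.v *)
Require Import Defs.
From HB Require Import structures.
From mathcomp Require Import all_boot all_order all_algebra.
From mathcomp Require Import all_classical all_reals all_analysis.
From mathcomp Require Import lra.

(** Everything follows from a two-sided estimate for a single functional
    f on E and a single x >= 0:
      sup_(0 <= y <= x) |f y| <= |f| x <= 2 sup_(0 <= y <= x) |f y|.
    Applied to f = T' f_n, whose values on [0, x] are those of f_n on T[0, x],
    it shows that |T' f_n| tends to 0 at x exactly when f_n tends to 0 uniformly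
    on T[0, x]; as every vector is a difference of positive ones, (|T' f_n|) is
    w*-null iff (f_n) is uniformly null on T[0, x] for all x >= 0
    ([weakstar_null_abs_adjoint]).  Both equivalences are this statement,
    quantified over disjoint w*-null sequences in one case and over all w*-null
    sequences in the other; the sets T[0, x] are bounded because the norm is
    monotone on the positive cone.

    The estimate rests on the Riesz-Kantorovich formula
      |f| x = sup_(- x <= y <= x) f y     (x >= 0)
    ([dual_absE]).  The right-hand side is additive in x >= 0, because an element
    of [- (x + z), x + z] splits as a sum of elements of [- x, x] and [- z, z]
    ([symmetric_interval_split]), so it extends to a bounded functional
    ([cone_extension]), which is then the least upper bound of f and - f.  The
    lower half of the estimate is the inclusion of [0, x] in [- x, x], and the
    upper half comes from writing y in [- x, x] as the difference
    (x + y) / 2 - (x - y) / 2 of two elements of [0, x]. *)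

Set Implicit Arguments.
Unset Strict Implicit.
Unset Printing Implicit Defensive.

Import Order.TTheory GRing.Theory Num.Theory.
Import numFieldNormedType.Exports.

Local Open Scope classical_set_scope.
Local Open Scope ring_scope.

(** * Order and norm in a Banach lattice *)

Section OrderedSpace.
Context {R : realType} (E : banachLatticeType R).
Implicit Types x y z : E.

Lemma bl_le_add2r z x y : (x + z <= y + z) = (x <= y).
Proof.
apply/idP/idP => h; last exact: banach_leD.
by rewrite -(addrK z x) -(addrK z y); apply: banach_leD.
Qed.

Lemma bl_subr_ge0 x y : (0 <= y - x) = (x <= y).
Proof. by rewrite -(bl_le_add2r x 0) add0r subrK. Qed.

Lemma bl_add x y z t : x <= y -> z <= t -> x + z <= y + t.
Proof.
move=> xy zt; apply: (@le_trans _ _ (y + z)); first by rewrite bl_le_add2r.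
by rewrite !(addrC y) bl_le_add2r.
Qed.

Lemma bl_addr_ge0 x y : 0 <= x -> 0 <= y -> 0 <= x + y.
Proof. by move=> x0 y0; rewrite -(addr0 0); apply: bl_add. Qed.

Lemma bl_oppr_le x y : (- x <= y) = (0 <= x + y).
Proof. by rewrite -bl_subr_ge0 opprK addrC. Qed.

Lemma bl_scale_ge0 (a : R) x : 0 <= a -> 0 <= x -> 0 <= a *: x.
Proof. by move=> a0 x0; rewrite -(scaler0 _ a); apply: banach_leZ. Qed.

Lemma bl_opp_le_self x : 0 <= x -> - x <= x.
Proof. by move=> x0; rewrite bl_oppr_le bl_addr_ge0. Qed.

Lemma bl_half (x : E) : 2^-1 *: x + 2^-1 *: x = x.
Proof. by rewrite -scalerDl -[RHS]scale1r; congr (_ *: _); lra. Qed.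

(** The modulus dominates x and - x, hence half of their sum, which is 0. *)
Lemma bl_modulus_ge0 x : 0 <= Order.join x (- x).
Proof.
set m := Order.join _ _; rewrite -(bl_half m) -scalerDr.
apply: bl_scale_ge0; first by rewrite invr_ge0.
by rewrite -(subrr x); apply: bl_add; [exact: leUl|exact: leUr].
Qed.

Lemma bl_norm_le x y : - x <= y -> y <= x -> `|y| <= `|x|.
Proof.
move=> xy yx; apply: banach_lattice_norm.
have h : Order.join y (- y) <= Order.join x (- x).
  apply: (@le_trans _ _ x); last exact: leUl.
  by rewrite leUx yx bl_oppr_le addrC -bl_oppr_le.
exact: h.
Qed.

Lemma bl_pos_sub_ge0 x : 0 <= Order.join x 0 - x.
Proof. by rewrite bl_subr_ge0; exact: leUl. Qed.

Lemma bl_norm_pos x : `|Order.join x 0| <= `|x|.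
Proof.
apply: banach_lattice_norm.
have p0 : 0 <= Order.join x 0 by exact: leUr.
have h : Order.join (Order.join x 0) (- Order.join x 0) <= Order.join x (- x).
  apply: (@le_trans _ _ (Order.join x 0)).
    by rewrite leUx lexx bl_opp_le_self.
  by rewrite leUx leUl bl_modulus_ge0.
exact: h.
Qed.

(** Riesz decomposition for symmetric intervals.  The two conditions on the first
    summand u are - x <= u <= x and y - z <= u <= y + z; the join of the lower
    bounds lies below both upper bounds. *)
Lemma symmetric_interval_split x z y : 0 <= x -> 0 <= z ->
  - (x + z) <= y <= x + z ->
  exists u v, [/\ y = u + v, - x <= u <= x & - z <= v <= z].
Proof.
move=> x0 z0 /andP[ly uy].
pose u := Order.join (- x) (y - z).
exists u, (y - u); split; first by rewrite addrC subrK.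
- rewrite leUl leUx bl_opp_le_self //=.
  by rewrite -(bl_le_add2r z) subrK.
- apply/andP; split.
  + rewrite bl_oppr_le addrA bl_subr_ge0 leUx; apply/andP; split.
      by rewrite bl_oppr_le addrA -bl_oppr_le.
    by rewrite (addrC z); apply: bl_add => //; exact: bl_opp_le_self.
  + have : y - z <= u by exact: leUr.
    by rewrite -(bl_le_add2r z) subrK -(bl_le_add2r u (y - u)) subrK addrC.
Qed.

(** * Extension of additive functions on the cone *)

(** The extension must send u - v to p u - p v for u, v >= 0, and additivity makes
    this independent of u and v.  Taking u to be the positive part of x, which
    has norm at most that of x, keeps it bounded. *)
Lemma cone_extension (p : E -> R) (M : R) :
  (forall x y, 0 <= x -> 0 <= y -> p (x + y) = p x + p y) ->
  (forall (a : R) x, 0 <= a -> 0 <= x -> p (a *: x) = a * p x) ->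
  0 <= M -> (forall x, 0 <= x -> `|p x| <= M * `|x|) ->
  exists h : dual E, forall x, 0 <= x -> h x = p x.
Proof.
move=> pD pZ M0 pM.
pose h (x : E) : R^o := p (Order.join x 0) - p (Order.join x 0 - x).
have hE u v : 0 <= u -> 0 <= v -> h (u - v) = p u - p v.
  move=> u0 v0; rewrite /h; set q := Order.join _ _.
  have q0 : 0 <= q by exact: leUr.
  have r0 : 0 <= q - (u - v) by exact: bl_pos_sub_ge0.
  have := pD _ _ u0 r0; have := pD _ _ v0 q0.
  have -> : u + (q - (u - v)) = v + q.
    by rewrite opprB addrCA (addrC u) subrK addrC.
  by move=> ->; lra.
have decomp x : exists u v, [/\ 0 <= u, 0 <= v & x = u - v].
  exists (Order.join x 0), (Order.join x 0 - x); split.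
  - exact: leUr.
  - exact: bl_pos_sub_ge0.
  - by rewrite opprB addrC subrK.
have hD x y : h (x + y) = h x + h y.
  have [u [v [u0 v0 ->]]] := decomp x; have [w [t [w0 t0 ->]]] := decomp y.
  rewrite addrACA -opprD !hE ?bl_addr_ge0 // !pD //.
  by rewrite opprD addrACA.
have hZ0 (a : R) x : 0 <= a -> h (a *: x) = a * h x.
  move=> a0; have [u [v [u0 v0 ->]]] := decomp x.
  by rewrite scalerBr !hE ?bl_scale_ge0 // !pZ // mulrBr.
have hN x : h (- x) = - h x.
  have [u [v [u0 v0 ->]]] := decomp x.
  by rewrite opprB !hE // opprB.
have hL : linear h.
  move=> a x y; rewrite hD; congr (_ + _).
  have [a0|a0] := leP 0 a; first exact: hZ0.
  by rewrite -[a]opprK scaleNr hN hZ0 ?oppr_ge0 ?ltW // -mulNr.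
have hM x : `|h x| <= (M + M * 2) * `|x|.
  apply: le_trans (ler_normB _ _) _; rewrite mulrDl -(mulrA M).
  apply: lerD.
    apply: le_trans (pM _ _) _; first exact: leUr.
    by apply: ler_wpM2l => //; exact: bl_norm_pos.
  apply: le_trans (pM _ _) _; first exact: bl_pos_sub_ge0.
  apply: ler_wpM2l => //; apply: le_trans (ler_normB _ _) _.
  by have := bl_norm_pos x; lra.
pose hlin := GRing.isLinear.Build R E R^o *:%R h hL.
pose hl : {linear E -> R^o} := HB.pack h hlin.
have hb : exists N : R, forall x, `|hl x| <= N * `|x| by exists (M + M * 2).
exists (BoundedOperator hb) => x x0.
rewrite /= -(subr0 x) hE // -[in p 0](scale0r x) pZ // mul0r.
by rewrite !subr0.
Qed.

(** * The Riesz-Kantorovich formula *)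

Definition interval_sup (f : dual E) x : R :=
  sup [set (f y : R) | y in [set y | - x <= y <= x]].

Section RieszKantorovich.
Variable f : dual E.

Lemma interval_sup_has_sup x : 0 <= x ->
  has_sup [set (f y : R) | y in [set y | - x <= y <= x]].
Proof.
move=> x0; split; first by exists (f x), x => //=; rewrite lexx bl_opp_le_self.
have [M fM] := operator_bounded f.
exists (`|M| * `|x|) => _ [y /= /andP[xy yx] <-].
apply: le_trans (ler_norm _) _; apply: le_trans (fM _) _.
apply: le_trans (ler_wpM2r _ (ler_norm M)) _ => //.
by apply: ler_wpM2l => //; exact: bl_norm_le.
Qed.

Lemma le_interval_sup x y : - x <= y <= x -> f y <= interval_sup f x.
Proof.
move=> xyx; apply: ub_le_sup; last by exists y.
apply: (proj2 (interval_sup_has_sup _)).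
have /andP[xy yx] := xyx.
have := le_trans xy yx; rewrite bl_oppr_le => x2.
by rewrite -(bl_half x) -scalerDr; apply: bl_scale_ge0.
Qed.

Lemma interval_sup_le x (c : R) : 0 <= x ->
  (forall y, - x <= y <= x -> f y <= c) -> interval_sup f x <= c.
Proof.
move=> x0 h; apply: ge_sup; first exact: (proj1 (interval_sup_has_sup x0)).
by move=> _ [y /= yx <-]; exact: h.
Qed.

Lemma interval_supD x z : 0 <= x -> 0 <= z ->
  interval_sup f (x + z) = interval_sup f x + interval_sup f z.
Proof.
move=> x0 z0; apply/le_anti/andP; split.
  apply: interval_sup_le => [|y]; first exact: bl_addr_ge0.
  move=> /(symmetric_interval_split x0 z0)[u [v [-> ux vz]]].
  by rewrite raddfD; apply: lerD; exact: le_interval_sup.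
rewrite -lerBrDr; apply: interval_sup_le => // u /andP[xu ux].
rewrite lerBrDr addrC -lerBrDr; apply: interval_sup_le => // v /andP[zv vz].
rewrite lerBrDr addrC -raddfD; apply: le_interval_sup.
by rewrite opprD !bl_add.
Qed.

Lemma interval_supZ (a : R) x : 0 <= a -> 0 <= x ->
  interval_sup f (a *: x) = a * interval_sup f x.
Proof.
have main (b : R) z : 0 < b -> 0 <= z ->
    b * interval_sup f z <= interval_sup f (b *: z).
  move=> b0 z0; rewrite mulrC -ler_pdivlMr //.
  apply: interval_sup_le => // y /andP[zy yz].
  rewrite ler_pdivlMr // mulrC.
  have -> : b * (f y : R) = f (b *: y) by rewrite linearZ.
  apply: le_interval_sup; rewrite -scalerN.
  by apply/andP; split; apply: banach_leZ => //; exact: ltW.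
move=> a0 x0; move: a0; rewrite le_eqVlt => /predU1P[<-|a0].
  rewrite scale0r mul0r.
  by have := interval_supD (lexx 0) (lexx 0); rewrite addr0; lra.
apply/le_anti; rewrite main // andbT.
have ai0 : 0 < a^-1 by rewrite invr_gt0.
have := main _ _ ai0 (bl_scale_ge0 (ltW a0) x0).
by rewrite scalerA mulVf ?gt_eqF // scale1r mulrC ler_pdivrMr // mulrC.
Qed.

Lemma interval_sup_bounded : exists2 M : R, 0 <= M &
  forall x, 0 <= x -> `|interval_sup f x| <= M * `|x|.
Proof.
have [M fM] := operator_bounded f; exists `|M| => // x x0.
rewrite ger0_norm; last first.
  have := @le_interval_sup x 0; rewrite raddf0; apply.
  by rewrite bl_oppr_le addr0 x0.
apply: interval_sup_le => // y /andP[xy yx].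
apply: le_trans (ler_norm _) _; apply: le_trans (fM _) _.
apply: le_trans (ler_wpM2r _ (ler_norm M)) _ => //.
by apply: ler_wpM2l => //; exact: bl_norm_le.
Qed.

Lemma symmetric_interval_diff x y : - x <= y <= x ->
  [/\ 0 <= 2^-1 *: (x + y) <= x, 0 <= 2^-1 *: (x - y) <= x,
      y = 2^-1 *: (x + y) - 2^-1 *: (x - y)
    & x = 2^-1 *: (x + y) + 2^-1 *: (x - y)].
Proof.
have h2 : (0 : R) <= 2^-1 by rewrite invr_ge0.
move=> /andP[]; rewrite bl_oppr_le -bl_subr_ge0 => w0 v0.
have ey : y = 2^-1 *: (x + y) - 2^-1 *: (x - y).
  by rewrite -scalerBr opprB addrCA (addrC x y) addrK scalerDr bl_half.
have ex : x = 2^-1 *: (x + y) + 2^-1 *: (x - y).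
  by rewrite -scalerDr addrCA addrK scalerDr bl_half.
split => //; rewrite bl_scale_ge0 //= -bl_subr_ge0 {1}ex.
- by rewrite addrC addKr bl_scale_ge0.
- by rewrite addrK bl_scale_ge0.
Qed.

(** An upper bound g of f and - f satisfies f y = f w - f v <= g w + g v = g x
    for w = (x + y) / 2 and v = (x - y) / 2, so the supremum over [- x, x] is
    the least possible value at x. *)
Lemma dual_absE x : 0 <= x -> dual_abs f x = interval_sup f x.
Proof.
move=> x0; have [M M0 fM] := interval_sup_bounded.
have [h hE] := cone_extension interval_supD interval_supZ M0 fM.
rewrite -hE //; congr (operator_fun _ x).
have hsup : supremums [set f; dual_opp f] h.
  split=> [g /= [->|->]|g ub].
  - apply/asboolP => y y0; rewrite hE //; apply: le_interval_sup.
    by rewrite lexx bl_opp_le_self.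
  - apply/asboolP => y y0; rewrite hE //.
    have -> : dual_opp f y = f (- y) by rewrite raddfN.
    by apply: le_interval_sup; rewrite lexx bl_opp_le_self.
  - have /asboolP fg : f <= g by apply: ub; left.
    have /asboolP nfg : dual_opp f <= g by apply: ub; right.
    apply/asboolP => y y0; rewrite hE //.
    apply: interval_sup_le => // z /symmetric_interval_diff[/andP[w0 _] /andP[v0 _]].
    move: (2^-1 *: _) (2^-1 *: _) w0 v0 => w v w0 v0 -> ->.
    by rewrite raddfB raddfD; apply: lerD; [exact: fg|exact: nfg].
rewrite /dual_abs /supremum; case: ifPn => [/eqP e|_].
  have : [set f; dual_opp f] f by left.
  by rewrite e.
by case: xgetP => [g _ gsup|/(_ h)//]; apply: is_subset1_supremums gsup hsup.
Qed.

(** * Comparison with order intervals *)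

Lemma le_dual_abs x y : 0 <= y <= x -> `|f y| <= dual_abs f x.
Proof.
move=> /andP[y0 yx]; have x0 := le_trans y0 yx.
rewrite dual_absE // ler_norml lerNl; apply/andP; split.
  have -> : - (f y : R) = f (- y) by rewrite raddfN.
  apply: le_interval_sup; rewrite bl_oppr_le bl_subr_ge0 yx /=.
  by apply: le_trans (bl_opp_le_self y0) yx.
by apply: le_interval_sup; rewrite yx andbT bl_oppr_le bl_addr_ge0.
Qed.

Lemma dual_abs_le x (c : R) : 0 <= x ->
  (forall y, 0 <= y <= x -> `|f y| <= c) -> dual_abs f x <= 2 * c.
Proof.
move=> x0 h; rewrite dual_absE //; apply: interval_sup_le => // y.
move=> /symmetric_interval_diff[wx vx -> _]; rewrite raddfB.
apply: le_trans (ler_norm _) _; apply: le_trans (ler_normB _ _) _.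
by rewrite mulr2n mulrDl mul1r; apply: lerD; exact: h.
Qed.

End RieszKantorovich.
End OrderedSpace.

(** * Adjoints and images of order intervals *)

Section Operators.
Context {R : realType} (E F : banachLatticeType R) (T : bounded_operator E F).

Lemma bounded_image_interval x : bounded_set (T @` [set y | 0 <= y <= x]).
Proof.
have [M TM] := operator_bounded T.
exists (`|M| * `|x|); split; first exact: num_real.
move=> c /ltW cM _ [y /= /andP[y0 yx] <-]; apply: le_trans cM.
apply: le_trans (TM _) _; apply: le_trans (ler_wpM2r _ (ler_norm M)) _ => //.
apply: ler_wpM2l => //; apply: bl_norm_le => //.
by rewrite bl_oppr_le bl_addr_ge0 // (le_trans y0 yx).
Qed.

Section SupImage.
Variables (f : dual F) (x : E).
Hypothesis x0 : 0 <= x.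
Let S := [set `|f a| | a in T @` [set y | 0 <= y <= x]].

Let S_ub : ubound S (dual_abs (adjoint T f) x).
Proof. by move=> _ [_ [y yx <-] <-]; exact: (le_dual_abs (adjoint T f)). Qed.

Let S_sup y : 0 <= y <= x -> `|f (T y)| <= sup S.
Proof.
move=> yx; apply: ub_le_sup; first by eexists; exact: S_ub.
by exists (T y) => //; exists y.
Qed.

Lemma sup_image_ge0 : 0 <= sup S.
Proof. by apply: le_trans (@S_sup 0 _); rewrite ?lexx. Qed.

Lemma sup_image_le_abs : sup S <= dual_abs (adjoint T f) x.
Proof.
apply: ge_sup; last exact: S_ub.
by exists `|f (T 0)|, (T 0) => //; exists 0 => //=; rewrite lexx.
Qed.

Lemma abs_le_sup_image : dual_abs (adjoint T f) x <= 2 * sup S.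
Proof. by apply: dual_abs_le => // y yx; exact: S_sup. Qed.

End SupImage.

Lemma weakstar_null_abs_adjoint (f : nat -> dual F) :
  weakstar_null (fun n => dual_abs (adjoint T (f n))) <->
  forall x : E, 0 <= x -> uniformly_null f (T @` [set y | 0 <= y <= x]).
Proof.
split=> [fT x x0|fT].
  apply: (@squeeze_cvgr _ _ _ _ (cst 0) (fun n => dual_abs (adjoint T (f n)) x)).
  - by apply: nearW => n; rewrite sup_image_ge0 // sup_image_le_abs.
  - exact: cvg_cst.
  - exact: fT.
have pos (x : E) : 0 <= x -> dual_abs (adjoint T (f n)) x @[n --> \oo] --> (0 : R).
  move=> x0; have lim2 := cvgM (cvg_cst (2 : R)) (fT x x0); rewrite mulr0 in lim2.
  refine (squeeze_cvgr _ (cvg_cst 0) (lim2 _ _)).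
  apply: nearW => n; apply/andP; split; last exact: abs_le_sup_image.
  exact: le_trans (sup_image_ge0 (f n) x0) (sup_image_le_abs (f n) x0).
move=> x.
have -> : (fun n => dual_abs (adjoint T (f n)) x : R) =
    (fun n => (dual_abs (adjoint T (f n)) (Order.join x 0) : R) -
              (dual_abs (adjoint T (f n)) (Order.join x 0 - x) : R)).
  by apply/funext => n; rewrite -raddfB opprB addrC subrK.
rewrite -(subr0 (0 : R)); apply: cvgB; apply: pos; first exact: leUr.
exact: bl_pos_sub_ge0.
Qed.

End Operators.

Theorem proposition2p2p7 (R : realType) (E F : banachLatticeType R)
    (T : bounded_operator E F) :
  (d_operator T <-> almost_o_limited T) /\
  (swl_operator T <-> o_limited T).
Proof.
split; split.
- move=> dT x x0; split=> [|f df wf]; first exact: bounded_image_interval.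
  exact: (weakstar_null_abs_adjoint T f).1 (dT f df wf) x x0.
- move=> aT f df wf; apply/weakstar_null_abs_adjoint => x x0.
  exact: (aT x x0).2.
- move=> sT x x0; split=> [|f wf]; first exact: bounded_image_interval.
  exact: (weakstar_null_abs_adjoint T f).1 (sT f wf) x x0.
- move=> oT f wf; apply/weakstar_null_abs_adjoint => x x0.
  exact: (oT x x0).2.
Qed.
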